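(* Let $\lambda\in(0,1/2)$. Let $(u_j^0)_{j\in\mathbf{Z}}$ be a $5$-configuration with $j_0=0$, that is, $u_j^0=0$ for $j\le0$, $u_j^0=1$ for $j\ge5$, and $0<u_1^0<u_2^0<u_3^0<u_4^0<1$. Put $\varepsilon^0=u_3^0-u_2^0$ and $$u_1^\infty=u_1^0-\frac{2\lambda-\lambda^2}{1-4\lambda^2}\varepsilon^0,\qquad u_2^\infty=u_3^\infty=\frac{1+\lambda}{1+2\lambda}u_2^0+\frac{\lambda}{1+2\lambda}u_3^0,\qquad u_4^\infty=u_4^0+\frac{1-\lambda^2}{1-4\lambda^2}\varepsilon^0,$$ with $u_j^\infty=0$ for $j\le0$ and $u_j^\infty=1$ for $j\ge5$. Suppose that (a) $u_2^0-u_1^0\ge2\varepsilon^0$; (b) $u_1^\infty\ge\lambda u_2^\infty$; (c) $\lambda(u_4^0-u_3^0)\ge(1-\lambda)\varepsilon^0$; (d) $u_4^0-u_3^0\ge\lambda(1-u_3^0)$; (e) $1-u_4^\infty\ge(1-\lambda^2)\varepsilon^0$. Let $(u^n)_{n\ge0}$ be the solution of the alternately shifted grid process with parameter $\lambda$ and initial data $(u_j^0)_{j\in\mathbf{Z}}$. Then for every $n\ge0$ the data at time $n$ is a $5$-configuration. Moreover, the solution converges uniformly exponentially fast towards $(u_j^\infty)_{j\in\mathbf{Z}}$ along even times: there exist $C>0$ and $\rho\in(0,1)$ such that $\sup_{j\in\mathbf{Z}}|u_j^{2n}-u_j^\infty|\le C\rho^n$ for all $n\ge0$.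
   Context: Alternately shifted grid process with parameter $\lambda\in(0,1)$. For $a\in\mathbf{R}$ let $\mathcal{C}_a=(a-1/2,a+1/2)$. The data at even times is a sequence $(u_j^{2n})_{j\in\mathbf{Z}}$, where $u_j^{2n}$ is attached to the cell $\mathcal{C}_j$; at odd times it is a sequence $(u_{j-\lambda}^{2n+1})_{j\in\mathbf{Z}}$, where $u_{j-\lambda}^{2n+1}$ is attached to $\mathcal{C}_{j-\lambda}$. From time $2n$ to $2n+1$ (grid shifted to the left): let $d_j^{2n}=\frac{u_j^{2n}-u_{j-1}^{2n}}{u_{j+1}^{2n}-u_{j-1}^{2n}}$ ($d_j^{2n}=-1$ if undefined). If $0<d_j^{2n}<1$, the reconstruction $u_{rec}^{2n}$ on $\mathcal{C}_j$ equals $u_{j-1}^{2n}$ where $d_j^{2n}<(j+1/2)-x<1$ and $u_{j+1}^{2n}$ where $0<(j+1/2)-x<d_j^{2n}$; otherwise $u_{rec}^{2n}=u_j^{2n}$ on $\mathcal{C}_j$. Then $u_{j-\lambda}^{2n+1}=\int_{\mathcal{C}_{j-\lambda}}u_{rec}^{2n}(x)\,dx$. From time $2n+1$ to $2n+2$ (grid shifted to the right): let $d_{j-\lambda}^{2n+1}=\frac{u_{j+1-\lambda}^{2n+1}-u_{j-\lambda}^{2n+1}}{u_{j+1-\lambda}^{2n+1}-u_{j-1-\lambda}^{2n+1}}$ ($-1$ if undefined). If $0<d_{j-\lambda}^{2n+1}<1$, the reconstruction $u_{rec}^{2n+1}$ on $\mathcal{C}_{j-\lambda}$ equals $u_{j-1-\lambda}^{2n+1}$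 where $0<x-(j-\lambda-1/2)<d_{j-\lambda}^{2n+1}$ and $u_{j+1-\lambda}^{2n+1}$ where $d_{j-\lambda}^{2n+1}<x-(j-\lambda-1/2)<1$; otherwise $u_{rec}^{2n+1}=u_{j-\lambda}^{2n+1}$ on $\mathcal{C}_{j-\lambda}$. Then $u_j^{2n+2}=\int_{\mathcal{C}_j}u_{rec}^{2n+1}(x)\,dx$. A sequence $(v_j)_{j\in\mathbf{Z}}$ is a $5$-configuration if there is $j_0\in\mathbf{Z}$ with $v_j=0$ for $j\le j_0$, $v_j=1$ for $j\ge j_0+5$, and $v_{j+1}-v_j>0$ for $j_0\le j\le j_0+4$. At odd times the data is called a $5$-configuration if the sequence $v_j=u_{j-\lambda}^{2n+1}$, $j\in\mathbf{Z}$, is one. *)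

(* Defs.v *)
From Stdlib Require Export Reals ZArith.
From Stdlib Require Import Zfloor.
From Coquelicot Require Export Coquelicot.
Open Scope R_scope.

(* Data at any time is stored as a sequence v : Z -> R.  At even times v j is
   the value u_j on the cell (j - 1/2, j + 1/2); at odd times v j is the value
   u_{j - lam} on the cell (j - lam - 1/2, j - lam + 1/2).

   The reconstructions are only meaningful off cell interfaces and off the jump
   inside a cell; at those isolated points the definitions below choose a
   one-sided value, which does not affect the integrals. *)

(* d_j at even times, with the value -1 when the quotient is undefined. *)
Definition d_even (v : Z -> R) (j : Z) : R :=
  if Req_EM_T (v (j + 1)%Z - v (j - 1)%Z) 0 then -1
  else (v j - v (j - 1)%Z) / (v (j + 1)%Z - v (j - 1)%Z).

(* d_{j - lam} at odd times. *)
Definition d_odd (v : Z -> R) (j : Z) : R :=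
  if Req_EM_T (v (j + 1)%Z - v (j - 1)%Z) 0 then -1
  else (v (j + 1)%Z - v j) / (v (j + 1)%Z - v (j - 1)%Z).

Definition in_unit (d : R) : {0 < d /\ d < 1} + {~ (0 < d /\ d < 1)} :=
  match Rlt_dec 0 d, Rlt_dec d 1 with
  | left h0, left h1 => left (conj h0 h1)
  | right h0, _ => right (fun h => h0 (proj1 h))
  | _, right h1 => right (fun h => h1 (proj2 h))
  end.

(* The floor gives the j whose cell contains x. *)
Definition rec_even (v : Z -> R) (x : R) : R :=
  let j := Zfloor (x + 1 / 2) in
  if in_unit (d_even v j) then
    if Rlt_dec ((IZR j + 1 / 2) - x) (d_even v j)
    then v (j + 1)%Z else v (j - 1)%Z
  else v j.

Definition rec_odd (lam : R) (v : Z -> R) (x : R) : R :=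
  let j := Zfloor (x + lam + 1 / 2) in
  if in_unit (d_odd v j) then
    if Rlt_dec (x - (IZR j - lam - 1 / 2)) (d_odd v j)
    then v (j - 1)%Z else v (j + 1)%Z
  else v j.

(* From an even to an odd time: the grid is shifted to the left by lam. *)
Definition shift_left (lam : R) (v : Z -> R) (j : Z) : R :=
  RInt (rec_even v) (IZR j - lam - 1 / 2) (IZR j - lam + 1 / 2).

(* From an odd to an even time: the grid is shifted back to the right. *)
Definition shift_right (lam : R) (v : Z -> R) (j : Z) : R :=
  RInt (rec_odd lam v) (IZR j - 1 / 2) (IZR j + 1 / 2).

Fixpoint asg_process (lam : R) (u0 : Z -> R) (n : nat) : Z -> R :=
  match n with
  | O => u0
  | S m => if Nat.even m then shift_left lam (asg_process lam u0 m)
           else shift_right lam (asg_process lam u0 m)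
  end.

Definition config5_at (j0 : Z) (v : Z -> R) : Prop :=
  (forall j : Z, (j <= j0)%Z -> v j = 0) /\
  (forall j : Z, (j0 + 5 <= j)%Z -> v j = 1) /\
  (forall j : Z, (j0 <= j <= j0 + 4)%Z -> v (j + 1)%Z - v j > 0).

Definition config5 (v : Z -> R) : Prop := exists j0 : Z, config5_at j0 v.

Definition eps0 (u0 : Z -> R) : R := u0 3%Z - u0 2%Z.

Definition u_inf (lam : R) (u0 : Z -> R) (j : Z) : R :=
  match j with
  | 1%Z => u0 1%Z - (2 * lam - lam ^ 2) / (1 - 4 * lam ^ 2) * eps0 u0
  | 2%Z | 3%Z =>
      (1 + lam) / (1 + 2 * lam) * u0 2%Z + lam / (1 + 2 * lam) * u0 3%Z
  | 4%Z => u0 4%Z + (1 - lam ^ 2) / (1 - 4 * lam ^ 2) * eps0 u0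
  | _ => if (j <=? 0)%Z then 0 else 1
  end.

(* Supremum over the integers, as an extended real. *)
Definition sup_Z (f : Z -> R) : Rbar :=
  Lub_Rbar (fun x : R => exists j : Z, x = f j).

(* Main.v *)
Require Import Defs.
From Stdlib Require Import Zfloor Lra Lia.

(* On nondecreasing data each reconstruction has at most one jump in its cell, so a
   half step only compares the position of the jump with the cut of the cell.
   Under (a)-(e) the outcome of every comparison is determined and two half
   steps form an affine map: it multiplies eps = u_3 - u_2 by 4 lam^2, moves
   each u_j by a multiple of eps, and fixes u_inf.  Hypotheses (b) and (e) are
   stated with the invariant u_inf, (a), (c), (d) get weaker along the process,
   and |u_j - u_inf_j| <= eps / (1 - 4 lam^2) at every even time. *)

(** * Integrals of one-jump functions over the two pieces of a cut cell *)

Lemma is_RInt_two_step (f : R -> R) (p m q l r : R) :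
  p <= m <= q ->
  (forall x, p < x < m -> f x = l) -> (forall x, m < x < q -> f x = r) ->
  is_RInt f p q ((m - p) * l + (q - m) * r).
Proof.
  intros hm hl hr.
  apply (is_RInt_Chasles f p m q ((m - p) * l) ((q - m) * r)).
  - apply is_RInt_ext with (fun _ => l); [|exact (is_RInt_const p m l)].
    intros x; rewrite Rmin_left, Rmax_right by lra.
    intros hx; symmetry; auto.
  - apply is_RInt_ext with (fun _ => r); [|exact (is_RInt_const m q r)].
    intros x; rewrite Rmin_left, Rmax_right by lra.
    intros hx; symmetry; auto.
Qed.

(* The integral over the right part, of length [mu], of a unit cell with
   average [u] whose reconstruction jumps up from [l] to [r]: the minimum
   distinguishes whether the jump lies left or right of that part. *)
Definition right_part (mu l u r : R) : R :=
  Rmin (mu * r) (u - (1 - mu) * l).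

(** Values at [p], [m] and [p + 1] are left free, since integrals ignore them. A constant cell with
    value [l] or [r] fits too, with the jump at an end. *)
Definition step_cell (f : R -> R) (p l u r : R) : Prop :=
  exists m, p <= m <= p + 1 /\ u = (m - p) * l + (p + 1 - m) * r /\
    (forall x, p < x < m -> f x = l) /\
    (forall x, m < x < p + 1 -> f x = r).

(** Since [(u - (1 - mu) * l) - mu * r = (q - m) * (r - l)], the sign of [q - m] decides the
    minimum: with the jump left of the cut [q] the right piece is constantly [r], otherwise the left
    piece is constantly [l]. *)
Lemma is_RInt_step_cell (f : R -> R) (p l u r q mu : R) :
  l <= u <= r -> 0 <= mu <= 1 -> step_cell f p l u r -> q = p + 1 - mu ->
  is_RInt f p q (u - right_part mu l u r) /\
  is_RInt f q (p + 1) (right_part mu l u r).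
Proof.
  intros hlr hmu (m & hm & hu & hl & hr) ->; unfold right_part.
  destruct (Rle_dec m (p + 1 - mu)) as [h|h].
  - rewrite Rmin_left by nra.
    split.
    + replace (u - mu * r) with ((m - p) * l + (p + 1 - mu - m) * r)
        by (rewrite hu; ring).
      apply is_RInt_two_step; auto; [lra|].
      intros x hx; apply hr; lra.
    + replace (mu * r)
        with ((p + 1 - mu - (p + 1 - mu)) * l + (p + 1 - (p + 1 - mu)) * r)
        by ring.
      apply is_RInt_two_step; [lra| |]; intros x hx; [lra|apply hr; lra].
  - rewrite Rmin_right by nra.
    split.
    + replace (u - (u - (1 - mu) * l))
        with ((p + 1 - mu - p) * l + (p + 1 - mu - (p + 1 - mu)) * r) by ring.
      apply is_RInt_two_step; [lra| |]; intros x hx; [apply hl; lra|lra].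
    + replace (u - (1 - mu) * l)
        with ((m - (p + 1 - mu)) * l + (p + 1 - m) * r) by (rewrite hu; ring).
      apply is_RInt_two_step; auto; [lra|].
      intros x hx; apply hl; lra.
Qed.

(** * The two reconstructions as one-jump functions *)

Lemma jump_fraction_spec (l u r a d : R) :
  l <= u <= r -> a = u - l \/ a = r - u ->
  d = (if Req_EM_T (r - l) 0 then -1 else a / (r - l)) ->
  (0 < d < 1 /\ d * (r - l) = a) \/ (~ 0 < d < 1 /\ (u = l \/ u = r)).
Proof.
  intros hu ha ->.
  (* The default -1 lies outside the unit interval, and [l = r] forces [u = l]. *)
  destruct (Req_EM_T (r - l) 0) as [h|h]; [right; lra|].
  set (d := a / (r - l)).
  assert (hd : d * (r - l) = a) by (unfold d; field; lra).
  destruct (Rlt_dec 0 d) as [h0|h0]; [destruct (Rlt_dec d 1) as [h1|h1]|].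
  - left; lra.
  (* As [0 <= a <= r - l], a quotient outside the open unit interval puts [u] at an end of the
     range. *)
  - right; split; [lra|nra].
  - right; split; [lra|nra].
Qed.

Lemma step_cell_const (f : R -> R) (p l u r : R) :
  u = l \/ u = r -> (forall x, p < x < p + 1 -> f x = u) ->
  step_cell f p l u r.
Proof.
  intros [->| ->] hf; [exists (p + 1)|exists p];
    (split; [lra|split; [ring|split; intros x hx; try lra; apply hf; lra]]).
Qed.

(** The average [v j] makes [d_even v j] the length of the upper piece, so the jump is measured from
    the right end; [d_odd v j] is the length of the lower piece, measured from the left end. *)
Lemma rec_even_step_cell (v : Z -> R) (j : Z) :
  v (j - 1)%Z <= v j <= v (j + 1)%Z ->
  step_cell (rec_even v) (IZR j - 1 / 2) (v (j - 1)%Z) (v j) (v (j + 1)%Z).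
Proof.
  intros hv.
  assert (hj : forall x, IZR j - 1 / 2 < x < IZR j - 1 / 2 + 1 ->
    Zfloor (x + 1 / 2) = j) by (intros x hx; apply Zfloor_eq; lra).
  destruct (jump_fraction_spec _ _ _ _ (d_even v j) hv (or_introl eq_refl)
    eq_refl) as [(hd & e)|(hd & hc)].
  - exists (IZR j + 1 / 2 - d_even v j).
    split; [lra|split; [nra|split]]; intros x hx; unfold rec_even;
      rewrite hj by lra;
      destruct (in_unit (d_even v j)); try tauto;
      destruct (Rlt_dec (IZR j + 1 / 2 - x) (d_even v j)); auto; lra.
  - apply step_cell_const; auto.
    intros x hx; unfold rec_even; rewrite hj by lra.
    destruct (in_unit (d_even v j)); tauto.
Qed.

Lemma rec_odd_step_cell (lam : R) (v : Z -> R) (j : Z) :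
  v (j - 1)%Z <= v j <= v (j + 1)%Z ->
  step_cell (rec_odd lam v) (IZR j - lam - 1 / 2)
    (v (j - 1)%Z) (v j) (v (j + 1)%Z).
Proof.
  intros hv.
  assert (hj : forall x, IZR j - lam - 1 / 2 < x < IZR j - lam - 1 / 2 + 1 ->
    Zfloor (x + lam + 1 / 2) = j) by (intros x hx; apply Zfloor_eq; lra).
  destruct (jump_fraction_spec _ _ _ _ (d_odd v j) hv (or_intror eq_refl)
    eq_refl) as [(hd & e)|(hd & hc)].
  - exists (IZR j - lam - 1 / 2 + d_odd v j).
    split; [lra|split; [nra|split]]; intros x hx; unfold rec_odd;
      rewrite hj by lra;
      destruct (in_unit (d_odd v j)); try tauto;
      destruct (Rlt_dec (x - (IZR j - lam - 1 / 2)) (d_odd v j)); auto; lra.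
  - apply step_cell_const; auto.
    intros x hx; unfold rec_odd; rewrite hj by lra.
    destruct (in_unit (d_odd v j)); tauto.
Qed.

(** * Half steps as exchanges between neighbouring cells *)

Definition right_flux (mu : R) (v : Z -> R) (j : Z) : R :=
  right_part mu (v (j - 1)%Z) (v j) (v (j + 1)%Z).

Definition nondecreasing (v : Z -> R) : Prop :=
  forall j : Z, v j <= v (j + 1)%Z.

Lemma nondecreasing_neighbors (v : Z -> R) (j : Z) :
  nondecreasing v -> v (j - 1)%Z <= v j <= v (j + 1)%Z.
Proof.
  intros hv; split; [|apply hv].
  generalize (hv (j - 1)%Z); replace (j - 1 + 1)%Z with j by lia; auto.
Qed.

(** The new cell [j] is made of the right piece, of length [lam], of the old cell [j - 1] and of the
    old cell [j] without its own right piece. *)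
Lemma shift_left_flux (lam : R) (v : Z -> R) (j : Z) :
  0 <= lam <= 1 -> nondecreasing v ->
  shift_left lam v j =
    right_flux lam v (j - 1) + (v j - right_flux lam v j).
Proof.
  intros hlam hv; apply is_RInt_unique.
  pose proof (nondecreasing_neighbors v j hv) as h1.
  pose proof (nondecreasing_neighbors v (j - 1) hv) as h0.
  apply (is_RInt_Chasles (rec_even v) _ (IZR j - 1 / 2)).
  - destruct (is_RInt_step_cell _ _ _ _ _ (IZR j - lam - 1 / 2) lam
      h0 hlam (rec_even_step_cell v (j - 1) h0)) as [_ h];
      [rewrite minus_IZR; lra|].
    replace (IZR (j - 1) - 1 / 2 + 1) with (IZR j - 1 / 2) in h
      by (rewrite minus_IZR; lra).
    exact h.
  - destruct (is_RInt_step_cell _ _ _ _ _ (IZR j - lam + 1 / 2) lam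
      h1 hlam (rec_even_step_cell v j h1)) as [h _]; [lra|exact h].
Qed.

(* Shifting the cells to the right by [lam] cuts each old cell in two pieces of
   lengths [lam] and [1 - lam], hence the parameter [1 - lam]. *)
Lemma shift_right_flux (lam : R) (v : Z -> R) (j : Z) :
  0 <= lam <= 1 -> nondecreasing v ->
  shift_right lam v j =
    right_flux (1 - lam) v j
    + (v (j + 1)%Z - right_flux (1 - lam) v (j + 1)).
Proof.
  intros hlam hv; apply is_RInt_unique.
  pose proof (nondecreasing_neighbors v j hv) as h0.
  pose proof (nondecreasing_neighbors v (j + 1) hv) as h1.
  apply (is_RInt_Chasles (rec_odd lam v) _ (IZR j - lam + 1 / 2)).
  - destruct (is_RInt_step_cell _ _ _ _ _ (IZR j - 1 / 2) (1 - lam)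
      h0 ltac:(lra) (rec_odd_step_cell lam v j h0)) as [_ h]; [lra|].
    replace (IZR j - lam - 1 / 2 + 1) with (IZR j - lam + 1 / 2) in h by lra.
    exact h.
  - destruct (is_RInt_step_cell _ _ _ _ _ (IZR j + 1 / 2) (1 - lam)
      h1 ltac:(lra) (rec_odd_step_cell lam v (j + 1) h1)) as [h _];
      [rewrite plus_IZR; lra|].
    replace (IZR (j + 1) - lam - 1 / 2) with (IZR j - lam + 1 / 2) in h
      by (rewrite plus_IZR; lra).
    exact h.
Qed.

(** Here the jump is left of the cut; the next lemma is the opposite case. The hypotheses are the
    comparisons that (a)-(e) settle below. *)
Lemma right_flux_r (mu : R) (v : Z -> R) (j : Z) :
  mu * v (j + 1)%Z <= v j - (1 - mu) * v (j - 1)%Z ->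
  right_flux mu v j = mu * v (j + 1)%Z.
Proof. apply Rmin_left. Qed.

Lemma right_flux_l (mu : R) (v : Z -> R) (j : Z) :
  v j - (1 - mu) * v (j - 1)%Z <= mu * v (j + 1)%Z ->
  right_flux mu v j = v j - (1 - mu) * v (j - 1)%Z.
Proof. apply Rmin_right. Qed.

(** * Monotonicity and boundary fluxes of a 5-configuration *)

Section Config5.

Variable v : Z -> R.
Hypothesis hv : config5_at 0 v.

Lemma config5_values :
  v 0%Z = 0 /\ 0 < v 1%Z /\ v 1%Z < v 2%Z /\ v 2%Z < v 3%Z /\
  v 3%Z < v 4%Z /\ v 4%Z < 1 /\ v 5%Z = 1.
Proof.
  destruct hv as (h0 & h1 & h).
  pose proof (h0 0%Z ltac:(lia)) as e0.
  pose proof (h1 5%Z ltac:(lia)) as e5.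
  pose proof (h 0%Z ltac:(lia)); pose proof (h 1%Z ltac:(lia)).
  pose proof (h 2%Z ltac:(lia)); pose proof (h 3%Z ltac:(lia)).
  pose proof (h 4%Z ltac:(lia)); simpl in *; lra.
Qed.

Lemma config5_nondecreasing : nondecreasing v.
Proof.
  intros j; destruct hv as (h0 & h1 & h).
  destruct (Z_lt_le_dec j 0); [rewrite !h0 by lia; lra|].
  destruct (Z_lt_le_dec j 5); [|rewrite !h1 by lia; lra].
  specialize (h j ltac:(lia)); lra.
Qed.

Lemma right_flux_low (mu : R) (j : Z) :
  0 <= mu -> (j <= 0)%Z -> right_flux mu v j = 0.
Proof.
  intros hmu hj; pose proof (config5_nondecreasing j) as h.
  destruct hv as (h0 & _).
  (* This includes [j = 0], whose right neighbour [v 1] is positive: only its sign matters. *)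
  rewrite right_flux_l; rewrite !(h0 j), (h0 (j - 1)%Z) by lia; [lra|].
  rewrite h0 in h by lia; nra.
Qed.

Lemma right_flux_high (mu : R) (j : Z) :
  mu <= 1 -> (5 <= j)%Z -> right_flux mu v j = mu.
Proof.
  intros hmu hj.
  pose proof (nondecreasing_neighbors v j config5_nondecreasing) as h.
  destruct hv as (_ & h1 & _).
  rewrite right_flux_r; rewrite !(h1 (j + 1)%Z) by lia; [lra|].
  rewrite !(h1 j) in * by lia; nra.
Qed.

End Config5.

Lemma config5_at_0_intro (v : Z -> R) :
  (forall j, (j <= 0)%Z -> v j = 0) -> (forall j, (5 <= j)%Z -> v j = 1) ->
  0 < v 1%Z -> v 1%Z < v 2%Z -> v 2%Z < v 3%Z -> v 3%Z < v 4%Z ->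
  v 4%Z < 1 -> config5_at 0 v.
Proof.
  intros h0 h1 v1 v2 v3 v4 v5; split; [exact h0|split; [exact h1|]].
  pose proof (h0 0%Z ltac:(lia)) as e0.
  pose proof (h1 5%Z ltac:(lia)) as e5.
  intros j hj.
  assert (hc : (j = 0 \/ j = 1 \/ j = 2 \/ j = 3 \/ j = 4)%Z) by lia.
  destruct hc as [->|[->|[->|[->| ->]]]]; simpl; lra.
Qed.

(** * The invariant at even times and its preservation by a double step *)

Definition admissible (lam : R) (u : Z -> R) : Prop :=
  config5_at 0 u /\
  u 2%Z - u 1%Z >= 2 * eps0 u /\
  u_inf lam u 1%Z >= lam * u_inf lam u 2%Z /\
  lam * (u 4%Z - u 3%Z) >= (1 - lam) * eps0 u /\
  u 4%Z - u 3%Z >= lam * (1 - u 3%Z) /\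
  1 - u_inf lam u 4%Z >= (1 - lam ^ 2) * eps0 u.

Lemma le_div (a k : R) : 0 <= a -> 0 < k <= 1 -> a <= a / k.
Proof.
  intros ha hk; apply Rle_div_r; [lra|].
  rewrite <- (Rmult_1_r a) at 2; apply Rmult_le_compat_l; lra.
Qed.

Section TwoSteps.

Variables (lam : R) (u : Z -> R).
Hypothesis hlam : 0 < lam < 1 / 2.
Hypothesis hu : admissible lam u.

Let v := shift_left lam u.
Let w := shift_right lam v.
Let e := eps0 u.

(** Transfers (b) and (e) from [u_inf] to [u], using that [u_inf] is below [u] at 1 and above it at
    2 and 4. *)
Lemma admissible_bounds :
  0 < e /\ lam * u 2%Z < u 1%Z /\ 1 - u 4%Z >= (1 - lam ^ 2) * e /\
  lam * u 2%Z < u_inf lam u 1%Z.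
Proof.
  destruct hu as (hc & ha & hb & _ & _ & he).
  apply config5_values in hc; fold e in ha, he.
  assert (he0 : 0 < e) by (unfold e, eps0; lra).
  assert (hq : 0 < 1 - 4 * lam ^ 2) by nra.
  assert (k1 : 0 < (2 * lam - lam ^ 2) / (1 - 4 * lam ^ 2) * e).
  { apply Rmult_lt_0_compat; [apply Rdiv_lt_0_compat; nra|lra]. }
  assert (k4 : 0 < (1 - lam ^ 2) / (1 - 4 * lam ^ 2) * e).
  { apply Rmult_lt_0_compat; [apply Rdiv_lt_0_compat; nra|lra]. }
  assert (k2 : u_inf lam u 2%Z = u 2%Z + lam / (1 + 2 * lam) * e).
  { unfold e, eps0; simpl; field; lra. }
  assert (k2' : 0 < lam / (1 + 2 * lam) * e).
  { apply Rmult_lt_0_compat; [apply Rdiv_lt_0_compat; lra|lra]. }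
  rewrite k2 in hb.
  simpl in *; fold e in hb, he |- *.
  repeat split; nra.
Qed.

(** The jump is left of the cut in cells 1, 2 and 4, and right of it in cell 3. Cell 1 uses (b),
    cell 2 uses (a); for cells 3 and 4 the comparisons are exactly (c) and (d). *)
Lemma shift_left_values :
  (forall j, (j <= 0)%Z -> v j = 0) /\ (forall j, (5 <= j)%Z -> v j = 1) /\
  v 1%Z = u 1%Z - lam * u 2%Z /\ v 2%Z = u 2%Z - lam * e /\
  v 3%Z = u 2%Z + lam * e /\ v 4%Z = u 4%Z - lam + lam * u 2%Z + e.
Proof.
  destruct admissible_bounds as (he0 & hb1 & _ & _).
  destruct hu as (hc & ha & _ & hcc & hd & _).
  destruct (config5_values u hc) as (u0 & u1 & u2 & u3 & u4 & u5 & u6).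
  assert (he : e = u 3%Z - u 2%Z) by reflexivity.
  fold e in ha, hcc.
  assert (f1 : right_flux lam u 1 = lam * u 2%Z)
    by (apply right_flux_r; simpl; rewrite u0; lra).
  assert (f2 : right_flux lam u 2 = lam * u 3%Z)
    by (apply right_flux_r; simpl; nra).
  assert (f3 : right_flux lam u 3 = u 3%Z - (1 - lam) * u 2%Z)
    by (apply right_flux_l; simpl; nra).
  assert (f4 : right_flux lam u 4 = lam)
    by (rewrite right_flux_r; simpl; rewrite u6; nra).
  assert (f0 := fun j => right_flux_low u hc lam j ltac:(lra)).
  assert (f5 := fun j => right_flux_high u hc lam j ltac:(lra)).
  pose proof (config5_nondecreasing u hc) as hm.
  assert (hs := fun j => shift_left_flux lam u j ltac:(lra) hm).
  destruct hc as (h0 & h1 & _).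
  unfold v; repeat split.
  - intros j hj; rewrite hs, !f0, h0 by lia; ring.
  - intros j hj; rewrite hs, (f5 j), h1 by lia.
    (* Cell 5 receives from cell 4, whose right piece already has the value 1 by [f4]. *)
    destruct (Z.eq_dec j 5) as [->|hj'].
    + simpl; rewrite f4; ring.
    + rewrite f5 by lia; ring.
  - rewrite hs; simpl; rewrite f0, f1 by lia; ring.
  - rewrite hs; simpl; rewrite f1, f2, he; ring.
  - rewrite hs; simpl; rewrite f2, f3, he; ring.
  - rewrite hs; simpl; rewrite f3, f4, he; ring.
Qed.

Lemma shift_left_config5 : config5_at 0 v.
Proof.
  destruct admissible_bounds as (he0 & hb1 & he4 & _).
  destruct shift_left_values as (v0 & v5 & v1 & v2 & v3 & v4).
  destruct hu as (hc & ha & _ & hcc & hd & _).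
  destruct (config5_values u hc) as (h0 & h1 & h2 & h3 & h4 & h5 & h6).
  assert (he : e = u 3%Z - u 2%Z) by reflexivity.
  fold e in ha, hcc.
  apply config5_at_0_intro; auto; rewrite ?v1, ?v2, ?v3, ?v4; nra.
Qed.

(** Now only cell 2 has its jump left of the cut. Cells 1 and 2 follow from (a); for cell 4 the
    comparison is exactly [1 - u 4 >= (1 - lam ^ 2) * e]. *)
Lemma two_step_values :
  (forall j, (j <= 0)%Z -> w j = 0) /\ (forall j, (5 <= j)%Z -> w j = 1) /\
  w 1%Z = u 1%Z - (2 * lam - lam ^ 2) * e /\
  w 2%Z = u 2%Z + lam * (1 - 2 * lam) * e /\
  w 3%Z = u 2%Z + (lam + 2 * lam ^ 2) * e /\
  w 4%Z = u 4%Z + (1 - lam ^ 2) * e.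
Proof.
  pose proof shift_left_config5 as hc'.
  destruct admissible_bounds as (he0 & hb1 & he4 & _).
  destruct shift_left_values as (v0 & v5 & v1 & v2 & v3 & v4).
  destruct hu as (hc & ha & _ & hcc & hd & _).
  destruct (config5_values u hc) as (h0 & h1 & h2 & h3 & h4 & h5 & h6).
  assert (he : e = u 3%Z - u 2%Z) by reflexivity.
  fold e in ha, hcc.
  pose proof (v0 0%Z ltac:(lia)) as v00.
  pose proof (v5 5%Z ltac:(lia)) as v55.
  assert (f1 : right_flux (1 - lam) v 1 = v 1%Z).
  { rewrite right_flux_l; simpl; rewrite v00, ?v1, ?v2; [ring|nra]. }
  assert (f2 : right_flux (1 - lam) v 2 = (1 - lam) * v 3%Z).
  { apply right_flux_r; simpl; rewrite v1, v2, v3; nra. }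
  assert (f3 : right_flux (1 - lam) v 3 = v 3%Z - lam * v 2%Z).
  { rewrite right_flux_l; simpl; [ring|rewrite v2, v3, v4].
    (* The comparison reads [lam * (v 3 - v 2) <= (1 - lam) * (v 4 - v 3)]. Here
       [v 3 - v 2 = 2 * lam * e], (d) gives [v 4 - v 3 >= 2 * (1 - lam) * e], and [lam < 1 / 2]
       concludes. *)
    assert (u 4%Z - lam - (1 - lam) * u 3%Z >= 0) by lra.
    assert (lam * (2 * lam * e) <= (1 - lam) * (2 * (1 - lam) * e)) by nra.
    assert ((1 - lam) * (u 4%Z - lam - (1 - lam) * u 3%Z) >= 0) by nra.
    rewrite he in *; nra. }
  assert (f4 : right_flux (1 - lam) v 4 = v 4%Z - lam * v 3%Z).
  { rewrite right_flux_l; simpl; [ring|rewrite v3, v4, v55; nra]. }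
  assert (f0 := fun j => right_flux_low v hc' (1 - lam) j ltac:(lra)).
  assert (f5 := fun j => right_flux_high v hc' (1 - lam) j ltac:(lra)).
  pose proof (config5_nondecreasing v hc') as hm.
  assert (hs := fun j => shift_right_flux lam v j ltac:(lra) hm).
  unfold w; repeat split.
  - intros j hj; rewrite hs, (f0 j) by lia.
    (* The new cell 0 takes the left piece of cell 1, which is empty of mass by [f1]. *)
    destruct (Z.eq_dec j 0) as [->|hj'].
    + simpl; rewrite f1; ring.
    + rewrite f0, v0 by lia; ring.
  - intros j hj; rewrite hs, !f5, v5 by lia; ring.
  - rewrite hs; simpl; rewrite f1, f2, v1, v2, v3; ring.
  - rewrite hs; simpl; rewrite f2, f3, v2, v3; ring.
  - rewrite hs; simpl; rewrite f3, f4, v2, v3; ring.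
  - rewrite hs; simpl; rewrite f4, f5, v3, v4, v55 by lia; ring.
Qed.

Lemma two_step_eps0 : eps0 w = 4 * lam ^ 2 * e.
Proof.
  destruct two_step_values as (_ & _ & _ & w2 & w3 & _).
  unfold eps0; rewrite w2, w3; ring.
Qed.

(** If a double step moves entry [j] by [c * e], then [u_inf] at [j] is
    [u j + c * e / (1 - 4 * lam ^ 2)], the geometric series of all moves to come. *)
Lemma two_step_u_inf (j : Z) : u_inf lam w j = u_inf lam u j.
Proof.
  pose proof two_step_eps0 as he'.
  destruct two_step_values as (_ & _ & w1 & w2 & w3 & w4).
  assert (he : e = u 3%Z - u 2%Z) by reflexivity.
  destruct j as [|[[[p|p|]|[p|p|]|]|[[p|p|]|[p|p|]|]|]|p]; try reflexivity;
    simpl in *; rewrite ?he'; fold e; rewrite ?w1, ?w2, ?w3, ?w4, ?he;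
    field; nra.
Qed.

(** Entry 1 decreases and entry 4 increases without passing their fixed limits, which keeps them
    inside the unit interval. *)
Lemma two_step_admissible : admissible lam w.
Proof.
  pose proof two_step_eps0 as he'.
  pose proof two_step_u_inf as hi.
  destruct two_step_values as (w0 & w5 & w1 & w2 & w3 & w4).
  destruct admissible_bounds as (he0 & hb1 & he4 & hb2).
  destruct hu as (hc & ha & hb & hcc & hd & hee).
  destruct (config5_values u hc) as (h0 & h1 & h2 & h3 & h4 & h5 & h6).
  assert (he : e = u 3%Z - u 2%Z) by reflexivity.
  fold e in ha, hcc, hee.
  assert (hsq : 0 < lam ^ 2 < lam / 2) by (clear - hlam; nra).
  assert (k1 : u_inf lam u 1%Z <= w 1%Z).
  { rewrite w1; unfold u_inf; fold e.
    assert (h : 2 * lam - lam ^ 2 <= (2 * lam - lam ^ 2) / (1 - 4 * lam ^ 2))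
      by (apply le_div; lra).
    apply (Rmult_le_compat_r e) in h; lra. }
  assert (k4 : w 4%Z <= u_inf lam u 4%Z).
  { rewrite w4; unfold u_inf; fold e.
    assert (h : 1 - lam ^ 2 <= (1 - lam ^ 2) / (1 - 4 * lam ^ 2))
      by (apply le_div; lra).
    apply (Rmult_le_compat_r e) in h; lra. }
  assert (hl2 : 0 < lam * u 2%Z) by (apply Rmult_lt_0_compat; lra).
  assert (e1 : lam * e < 1 / 2 * e) by (apply Rmult_lt_compat_r; lra).
  assert (e2 : 0 < lam ^ 2 * e) by (apply Rmult_lt_0_compat; lra).
  assert (e3 : lam ^ 2 * e < lam / 2 * e) by (apply Rmult_lt_compat_r; lra).
  repeat split; rewrite ?hi, ?he'; auto.
  - apply config5_at_0_intro; auto; rewrite ?w1, ?w2, ?w3, ?w4 in *; lra.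
  - rewrite w1, w2; lra.
  - rewrite w3, w4.
    (* The gap [u 4 - u 3] grows by [(1 + lam) * (2 - 3 * lam) * e]. *)
    assert (0 < lam * ((1 + lam) * (2 - 3 * lam) * e)).
    { repeat apply Rmult_lt_0_compat; lra. }
    assert ((1 - lam) * (4 * lam ^ 2 * e) <= (1 - lam) * e).
    { apply Rmult_le_compat_l; lra. }
    assert (he3 : u 3%Z = u 2%Z + e) by lra.
    rewrite he3 in hcc; lra.
  - rewrite w3, w4.
    (* The slack [u 4 - lam - (1 - lam) * u 3] of (d) grows by twice this quantity. *)
    assert (0 < (1 - lam) * ((1 - lam ^ 2) * e)).
    { repeat apply Rmult_lt_0_compat; lra. }
    assert (he3 : u 3%Z = u 2%Z + e) by lra.
    rewrite he3 in hd; lra.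
  - assert ((1 - lam ^ 2) * (4 * lam ^ 2 * e) <= (1 - lam ^ 2) * e).
    { apply Rmult_le_compat_l; lra. }
    lra.
Qed.

Lemma dist_u_inf_le (j : Z) :
  Rabs (u j - u_inf lam u j) <= e / (1 - 4 * lam ^ 2).
Proof.
  destruct admissible_bounds as (he0 & _).
  destruct hu as ((h0 & h1 & _) & _).
  assert (hq : 0 < 1 - 4 * lam ^ 2) by nra.
  assert (he : e = u 3%Z - u 2%Z) by reflexivity.
  (* Below, [c] is minus the coefficient of [e] in the move of entry [j] under a double step, and 0
     outside the entries 1 to 4. *)
  assert (hc : forall c x, -1 <= c <= 1 -> x = c * (e / (1 - 4 * lam ^ 2)) ->
    Rabs x <= e / (1 - 4 * lam ^ 2)).
  { intros c x hc ->.
    assert (0 < e / (1 - 4 * lam ^ 2)) by (apply Rdiv_lt_0_compat; lra).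
    apply Rabs_le; nra. }
  destruct (Z_lt_le_dec j 1) as [hj|hj].
  { apply (hc 0); [lra|].
    rewrite h0 by lia.
    destruct j as [|p|p]; [simpl; ring|lia|simpl; ring]. }
  destruct (Z_lt_le_dec j 5) as [hj'|hj'].
  - assert (hcases : (j = 1 \/ j = 2 \/ j = 3 \/ j = 4)%Z) by lia.
    destruct hcases as [->|[->|[->| ->]]].
    + apply (hc (2 * lam - lam ^ 2)); [nra|]; simpl; fold e; field; nra.
    + apply (hc (- (lam * (1 - 2 * lam)))); [nra|]; simpl; rewrite he.
      field; nra.
    + apply (hc ((1 + lam) * (1 - 2 * lam))); [nra|]; simpl; rewrite he.
      field; nra.
    + apply (hc (- (1 - lam ^ 2))); [nra|]; simpl; fold e; field; nra.
  - apply (hc 0); [lra|].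
    rewrite h1 by lia.
    destruct j as [|[[[p|p|]|[p|p|]|]|[[p|p|]|[p|p|]|]|]|p]; try lia;
      simpl; ring.
Qed.

End TwoSteps.

(** * Iteration of the double step and convergence *)

Lemma asg_process_even_succ (lam : R) (u0 : Z -> R) (n : nat) :
  asg_process lam u0 (2 * S n) =
  shift_right lam (shift_left lam (asg_process lam u0 (2 * n))).
Proof.
  replace (2 * S n)%nat with (S (S (2 * n))) by lia.
  cbn [asg_process].
  now rewrite Nat.even_succ, <- Nat.negb_even, Nat.even_even.
Qed.

Lemma asg_process_odd (lam : R) (u0 : Z -> R) (n : nat) :
  asg_process lam u0 (S (2 * n)) = shift_left lam (asg_process lam u0 (2 * n)).
Proof. cbn [asg_process]; now rewrite Nat.even_even. Qed.

Lemma asg_process_even_admissible (lam : R) (u0 : Z -> R) (n : nat) :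
  0 < lam < 1 / 2 -> admissible lam u0 ->
  let u := asg_process lam u0 (2 * n) in
  admissible lam u /\ eps0 u = (4 * lam ^ 2) ^ n * eps0 u0 /\
  (forall j, u_inf lam u j = u_inf lam u0 j).
Proof.
  intros hlam h0; induction n as [|n (hadm & heps & hinf)]; cbv zeta.
  - simpl; repeat split; auto; ring || apply h0.
  - rewrite asg_process_even_succ; split; [|split].
    + now apply two_step_admissible.
    + rewrite two_step_eps0, heps by assumption; simpl; ring.
    + intros j; rewrite two_step_u_inf by assumption; apply hinf.
Qed.

Theorem proposition13 (lam : R) (u0 : Z -> R)
  (hlam : 0 < lam < 1 / 2)
  (hu0 : config5_at 0 u0)
  (ha : u0 2%Z - u0 1%Z >= 2 * eps0 u0)
  (hb : u_inf lam u0 1%Z >= lam * u_inf lam u0 2%Z)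
  (hc : lam * (u0 4%Z - u0 3%Z) >= (1 - lam) * eps0 u0)
  (hd : u0 4%Z - u0 3%Z >= lam * (1 - u0 3%Z))
  (he : 1 - u_inf lam u0 4%Z >= (1 - lam ^ 2) * eps0 u0) :
  (forall n : nat, config5 (asg_process lam u0 n)) /\
  (exists C rho : R, C > 0 /\ 0 < rho < 1 /\
     forall n : nat,
       Rbar_le
         (sup_Z (fun j : Z =>
            Rabs (asg_process lam u0 (2 * n)%nat j - u_inf lam u0 j)))
         (Finite (C * rho ^ n))).
Proof.
  assert (h0 : admissible lam u0) by (unfold admissible; auto 7).
  assert (hq : 0 < 1 - 4 * lam ^ 2) by nra.
  split.
  - intros n; exists 0%Z.
    destruct (Nat.Even_or_Odd n) as [[m ->]|[m ->]];
      destruct (asg_process_even_admissible lam u0 m hlam h0) as (hm & _).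
    + apply hm.
    + rewrite Nat.add_1_r, asg_process_odd.
      now apply shift_left_config5.
  (* The distance bound at time [2 * n] involves the current [eps0], which is
     [(4 * lam ^ 2) ^ n * eps0 u0]. *)
  - exists (eps0 u0 / (1 - 4 * lam ^ 2)), (4 * lam ^ 2).
    split; [|split; [nra|]].
    { apply Rdiv_lt_0_compat; [|lra].
      apply (admissible_bounds lam u0 hlam h0). }
    intros n.
    destruct (asg_process_even_admissible lam u0 n hlam h0)
      as (hm & heps & hinf).
    apply (proj2 (Lub_Rbar_correct _)).
    intros x (j & ->); cbn [Rbar_le].
    (* The limit is rewritten with the data at time [2 * n], to which [dist_u_inf_le] applies. *)
    rewrite <- hinf.
    eapply Rle_trans; [exact (dist_u_inf_le lam _ hlam hm j)|].
    rewrite heps; apply Req_le; unfold Rdiv; ring.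
Qed.
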